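(* Let $T$ be a linear operator generated by an endomorphism $\tau$ of $(\Omega,\beta,\mu)$, let $S_ng=\frac1n\sum_{i=0}^{n-1}T^ig$, and let $f\in L_p(\Omega,X)$, $p>1$. If $\sup_{n_2}\|E(f|F_{n_2})\|_X\in L_1$, then for any $\varepsilon>0$ $$\mu\Big\{\sup_{n_1,n_2}\|S_{n_1}(E(f|F_{n_2}))\|_X\ge\varepsilon\Big\}\le\left(\frac p{p-1}\right)^p\frac{\|f\|_p^p}{\varepsilon^p}.$$
   Context: $X$ is a reflexive Banach space with norm $\|\cdot\|_X$, and $(\Omega,\beta,\mu)$ is a finite measure space. For $1\le p<\infty$, $L_p(\Omega,X)$ is the Banach space of (strongly) measurable functions $f:\Omega\to X$ with finite norm $\|f\|_p=\left(\int_\Omega\|f(\omega)\|_X^p\,d\mu\right)^{1/p}$; $L_p$ denotes this space for $X=\mathbb R$. For $f$ with values in $X$, $\|f\|_X$ denotes the function $\omega\mapsto\|f(\omega)\|_X$. $E(f|F)$ is the conditional expectation of $f$ with respect to a $\sigma$-subalgebra $F\subset\beta$. $(F_n)_{n\ge1}$ is a monotone (increasing or decreasing) sequence of $\sigma$-subalgebras of $\beta$, with $F_n\uparrow F_\infty$ or $F_n\downarrow F_\infty$. A linear operator $T:L_1(\Omega,X)\to L_1(\Omega,X)$ is generated by an endomorphism $\tau$ (a measure-preserving transformation of $(\Omega,\beta,\mu)$) if $Tf=f\circ\tau$. *)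

(* Defs.v *)
From HB Require Import structures.
From mathcomp Require Import all_boot all_order all_algebra.
From mathcomp Require Import all_classical all_reals all_analysis.
Import Order.TTheory GRing.Theory Num.Theory.
Import numFieldNormedType.Exports.

Set Implicit Arguments.
Unset Strict Implicit.
Unset Printing Implicit Defensive.

Local Open Scope classical_set_scope.
Local Open Scope ring_scope.

Section Reflexivity.
Context {R : realType} {X : normedModType R}.

Definition dual : set (X -> R) := [set l : X -> R | scalar l /\ continuous l].

Definition dual_norm (l : X -> R) : R :=
  sup [set `|l x| | x in [set x : X | `|x| <= 1]].

(* Elements of X** are functionals on all of X -> R of which only the values on
   [dual] matter. *)
Definition bidual : set ((X -> R) -> R) :=
  [set Phi |
    (forall (a : R) (l m : X -> R), dual l -> dual m ->
       Phi (fun x => a * l x + m x) = a * Phi l + Phi m) /\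
    (exists C : R, forall l, dual l -> `|Phi l| <= C * dual_norm l)].

End Reflexivity.

Definition reflexive_space {R : realType} (X : normedModType R) : Prop :=
  forall Phi, @bidual R X Phi ->
    exists x : X, forall l, dual l -> Phi l = l x.

Definition sigma_subalgebra {d} {T : measurableType d}
    (G : set (set T)) : Prop :=
  sigma_algebra setT G /\ G `<=` @measurable d T.

Definition increases_to {T : Type} (F : nat -> set (set T))
    (Finf : set (set T)) : Prop :=
  (forall m n, (1 <= m)%N -> (m <= n)%N -> F m `<=` F n) /\
  Finf = <<s \bigcup_(n in [set n | (1 <= n)%N]) F n >>.

Definition decreases_to {T : Type} (F : nat -> set (set T))
    (Finf : set (set T)) : Prop :=
  (forall m n, (1 <= m)%N -> (m <= n)%N -> F n `<=` F m) /\
  Finf = \bigcap_(n in [set n | (1 <= n)%N]) F n.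

Section StrongMeasurability.
Context {R : realType} {X : normedModType R} {T : Type}.

Definition simple_function (G : set (set T)) (s : T -> X) : Prop :=
  finite_set (range s) /\ forall x, G (s @^-1` [set x]).

(* Pointwise limits everywhere: relative to a sub-sigma-algebra [G], an
   almost-everywhere limit need not be [G]-measurable. *)
Definition strongly_measurable (G : set (set T)) (f : T -> X) : Prop :=
  exists s : nat -> T -> X, (forall n, simple_function G (s n)) /\
    forall t, s n t @[n --> \oo] --> f t.

End StrongMeasurability.

Section Bochner.
Context {R : realType} {X : completeNormedModType R}.
Context {d : measure_display} {T : measurableType d}.
Variable mu : {finite_measure set T -> \bar R}.

Definition bochner_norm (p : R) (f : T -> X) : \bar R :=
  Lnorm mu p%:E (fun t => (`|f t|)%:E).

Definition bochner_Lp (p : R) (f : T -> X) : Prop :=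
  strongly_measurable measurable f /\ (bochner_norm p f < +oo)%E.

Definition simple_integral (A : set T) (s : T -> X) : X :=
  \sum_(x \in range s) fine (mu (A `&` s @^-1` [set x])) *: x.

Definition has_bochner_integral (A : set T) (f : T -> X) (v : X) : Prop :=
  strongly_measurable measurable f /\
  exists s : nat -> T -> X,
    [/\ forall n, simple_function measurable (s n),
        (\int[mu]_(t in A) (`|f t - s n t|)%:E)%E @[n --> \oo] --> 0%E &
        simple_integral A (s n) @[n --> \oo] --> v].

(* [g] is a version of E(f|G). *)
Definition is_condexp (G : set (set T)) (f g : T -> X) : Prop :=
  [/\ strongly_measurable G g,
      bochner_Lp 1 g &
      forall A, G A -> exists v,
        has_bochner_integral A f v /\ has_bochner_integral A g v].

Definition endomorphism (tau : T -> T) : Prop :=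
  measurable_fun setT tau /\
  forall A, measurable A -> mu (tau @^-1` A) = mu A.

End Bochner.

Definition generated_operator {T U : Type} (tau : T -> T) (f : T -> U) :
  T -> U := f \o tau.

Definition ergodic_average {R : realType} {X : normedModType R} {T : Type}
    (S : (T -> X) -> (T -> X)) (n : nat) (g : T -> X) (t : T) : X :=
  n%:R^-1 *: \sum_(0 <= i < n) iter i S g t.

(* Main.v *)
Require Import Defs.
From HB Require Import structures.
From mathcomp Require Import all_boot all_order all_algebra.
From mathcomp Require Import all_classical all_reals all_analysis measurable_realfun.
From mathcomp Require Import ring lra zify.
Import Order.TTheory GRing.Theory Num.Theory.
Import numFieldNormedType.Exports.
Import HBNNSimple.

Set Implicit Arguments.
Unset Strict Implicit.
Unset Printing Implicit Defensive.

Local Open Scope classical_set_scope.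
Local Open Scope ring_scope.

(** Taking norms inside an average gives [|S_n (E(f|F_m))| <= S_n |E(f|F_m)|], so
    everything is dominated by the ergodic maximal function of
    [h = sup_m |E(f|F_m)|], a real function. Two classical inequalities finish.

    The maximal ergodic theorem bounds [c * mu (sup_n S_n g > c)] by the integral
    of [g]. By convexity of the [p]-th power, [S_n h > c] forces
    [S_n (h^p) > c^p], so with [g = h^p] the measure of [sup_n S_n h > c] is at
    most [c^-p] times the integral of [h^p] ([powR_maximal_ergodic]).

    Doob's inequality bounds the integral of [h^p] by [(p / (p - 1))^p] times that
    of [|f|^p] ([doob_running_max]). All that it needs to know of the conditional
    expectations is that [|E(f|F_m)|] has at most the integral of [|f|] over the
    sets of [F_m] ([condexp_norm_le]). Indeed, [E(f|F_m)] is almost constant on the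
    pieces of a countable partition into sets of [F_m], and on a piece where it
    is almost [x] the integral of its norm is almost the norm of its integral,
    which is also the integral of [f] over that piece.

    Suprema are handled by exhaustion. For finitely many indices and norms
    truncated at a finite level all functions are bounded, hence their integrals
    are finite and can be subtracted, and an increasing and a decreasing
    sequence of sigma-algebras differ only by the order of enumeration. The sharp constants of both convexity arguments come from one
    form of Young's inequality, [powR_young]. *)

(** * Young's inequality *)

(** Young's inequality for the conjugate exponents [p] and [p / (p - 1)], in the
    form of a tangent inequality: [b] is the point where the [p]-th power is
    linearised. *)
Lemma powR_young (R : realType) (p a b : R) : 1 < p -> 0 <= a -> 0 <= b ->
  p * (a * b `^ (p - 1)) <= a `^ p + (p - 1) * b `^ p.
Proof.
move=> p1 a0 b0; have p0 : 0 < p by lra.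
have p10 : 0 < p - 1 by lra.
have conj : p^-1 + (p / (p - 1))^-1 = 1 by field; rewrite !gt_eqF.
have := conjugate_powR a0 (powR_ge0 b (p - 1)) p0 (divr_gt0 p0 p10) conj.
have -> : (b `^ (p - 1)) `^ (p / (p - 1)) = b `^ p.
  by rewrite -powRrM; congr powR; field; rewrite gt_eqF.
rewrite -(ler_pM2l p0) => /le_trans; apply.
rewrite le_eqVlt; apply/orP; left; apply/eqP; field.
by rewrite !gt_eqF.
Qed.

(** Jensen's inequality for the mean of the [a i], obtained by adding the tangent
    inequalities at [c]. *)
Lemma powR_mean_gt (R : realType) (p c : R) (n : nat) (a : nat -> R) :
  1 < p -> 0 < c -> (forall i, 0 <= a i) ->
  n%:R * c < \sum_(0 <= i < n) a i ->
  n%:R * c `^ p < \sum_(0 <= i < n) a i `^ p.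
Proof.
move=> p1 c0 a0 ca.
have p0 : 0 < p by lra.
have cp : 0 < c `^ (p - 1) by exact: powR_gt0.
have cpE : c * c `^ (p - 1) = c `^ p by rewrite mulr_powRB1// ltW.
have H : p * ((\sum_(0 <= i < n) a i) * c `^ (p - 1)) <=
    \sum_(0 <= i < n) a i `^ p + n%:R * ((p - 1) * c `^ p).
  rewrite mulr_suml mulr_sumr.
  rewrite (_ : n%:R * _ = \sum_(0 <= i < n) (p - 1) * c `^ p); last first.
    by rewrite sumr_const_nat subn0 mulr_natl.
  rewrite -big_split/=; apply: ler_sum => i _.
  by apply: powR_young => //; exact: ltW.
have : p * (n%:R * c * c `^ (p - 1)) <
    p * ((\sum_(0 <= i < n) a i) * c `^ (p - 1)).
  by rewrite ltr_pM2l// ltr_pM2r.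
move=> /lt_le_trans/(_ H); rewrite -mulrA cpE => {}H.
rewrite -subr_gt0; move: H; rewrite -subr_gt0; congr (0 < _); ring.
Qed.

(** * The maximal ergodic inequality *)

(** The maximum over [k <= n] of the Birkhoff sums of [f] of length [k], the empty
    sum included. The recursion singles out the first term of a sum: what
    remains is a Birkhoff sum started at [tau t]. *)
Fixpoint max_birkhoff {R : realType} {T : Type} (tau : T -> T) (f : T -> R)
    (n : nat) (t : T) : R :=
  if n is m.+1 then Num.max 0 (f t + max_birkhoff tau f m (tau t)) else 0.
Arguments max_birkhoff : simpl never.

Section maximal_ergodic.
Context {R : realType} {d : measure_display} {T : measurableType d}.
Variable mu : {finite_measure set T -> \bar R}.
Variable tau : T -> T.
Hypothesis tau_endo : endomorphism mu tau.

Lemma ge0_integral_endomorphism (h : T -> R) :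
  measurable_fun setT h -> (forall t, 0 <= h t) ->
  (\int[mu]_t (h (tau t))%:E = \int[mu]_t (h t)%:E)%E.
Proof.
move=> mh h0; have [mtau mutau] := tau_endo.
have := ge0_integral_pushforward mtau mu measurableT
  (iffRL (measurable_EFinP _ _) mh).
rewrite preimage_setT => <- /=; last by move=> y _; rewrite lee_fin.
apply: eq_measure_integral => A mA _; exact: mutau.
Qed.

Let P (g : T -> R) (c : R) := max_birkhoff tau (fun t => g t - c).

Let P_S g c n t : P g c n.+1 t = Num.max 0 (g t - c + P g c n (tau t)).
Proof. by []. Qed.

Let P_ge0 g c n t : 0 <= P g c n t.
Proof. by case: n => [|n] //=; rewrite le_max lexx. Qed.

Let P_homo g c n t : P g c n t <= P g c n.+1 t.
Proof.
elim: n t => [|n IH] t; first exact: P_ge0.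
by rewrite !P_S le_max2// lerD2l IH.
Qed.

Let measurable_P g c n : measurable_fun setT g -> measurable_fun setT (P g c n).
Proof.
move=> mg; elim: n => [|n IH] //=; first exact: measurable_cst.
apply: measurable_maxr => //.
apply: measurable_funD; first exact: measurable_funB.
by apply: measurableT_comp => //; case: tau_endo.
Qed.

Let P_le (g : T -> R) (c K : R) n t : 0 <= c -> (forall t, 0 <= g t <= K) ->
  P g c n t <= n%:R * K.
Proof.
move=> c0 gK; elim: n t => [|n IH] t; first by rewrite mul0r.
have := IH (tau t); have /andP[g0 gk] := gK t => H.
rewrite P_S ge_max mulr_ge0//=; last by apply: le_trans gk.
rewrite -natr1 mulrDl mul1r; lra.
Qed.

Let le_P g c n m t : (n <= m)%N ->
  \sum_(0 <= i < n) (g (iter i tau t) - c) <= P g c m t.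
Proof.
elim: n m t => [|n IH] m t nm; first by rewrite big_geq.
case: m nm => // m nm.
rewrite big_nat_recl//= le_max lerD2l; apply/orP; right.
under eq_bigr do rewrite -iterS iterSr.
exact: IH.
Qed.

(** Garsia's argument: with [P] the maximal Birkhoff sum of [g - c], the recursion
    gives [c * \1_E + P <= g + P \o tau] pointwise, because [P > 0] on [E]. As [tau]
    preserves the integral of the bounded function [P], it cancels. *)
Lemma maximal_ergodic (g : T -> R) (K c : R) (N : nat) (E : set T) :
  measurable_fun setT g -> (forall t, 0 <= g t <= K) -> 0 < c -> measurable E ->
  E `<=` [set t | exists2 n, (n <= N)%N &
      n%:R * c < \sum_(0 <= i < n) g (iter i tau t)] ->
  (c%:E * mu E <= \int[mu]_t (g t)%:E)%E.
Proof.
move=> mg gK c0 mE E_gt.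
have g0 t : 0 <= g t by case/andP: (gK t).
have mP : measurable_fun setT (P g c N) by exact: measurable_P.
have E_P t : E t -> 0 < P g c N t.
  move=> /E_gt[n nN nc]; apply: lt_le_trans (le_P g c t nN).
  by rewrite sumrB sumr_const_nat subn0 subr_gt0 -mulr_natl.
have key t : c * \1_E t + P g c N t <= g t + P g c N (tau t).
  have [Pt|Pt] := leP (P g c N t) 0.
    have /negPf tE : t \notin E by rewrite notin_setE => /E_P; rewrite ltNge Pt.
    by rewrite indicE tE mulr0 add0r (le_trans Pt)// addr_ge0.
  have E1 : c * \1_E t <= c by rewrite indicE ger_pMr//; case: (t \in E).
  have := P_homo g c N t; rewrite P_S le_max.
  rewrite leNgt Pt/=; lra.
have intP : (\int[mu]_t (P g c N t)%:E \is a fin_num)%E.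
  rewrite ge0_fin_numE; last by apply: integral_ge0 => t _; rewrite lee_fin.
  apply: (@le_lt_trans _ _ (\int[mu]_t (cst (N%:R * K)%:E t))%E).
    apply: ge0_le_integral => //=.
    - by move=> t _; rewrite lee_fin.
    - exact/measurable_EFinP.
    - by move=> t _; rewrite lee_fin; apply: P_le => //; exact: ltW.
  by rewrite integral_cst// lte_mul_pinfty// ?ltey_eq ?fin_num_measure//
    lee_fin (le_trans _ (@P_le g c K N point (ltW c0) gK)).
rewrite -(@leeD2rE _ _ _ _ intP).
rewrite -{2}(ge0_integral_endomorphism mP)//.
rewrite -(ge0_integralD mu measurableT)//; last 4 first.
- by move=> t _; rewrite lee_fin.
- exact/measurable_EFinP.
- by move=> t _; rewrite lee_fin.
- by apply/measurable_EFinP; apply: measurableT_comp => //; case: tau_endo.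
have mindic : measurable_fun setT (fun t => (\1_E t : R)%:E).
  by apply/measurable_EFinP; exact: measurable_indic.
rewrite -[X in mu X]setIT -(integral_indic mu measurableT mE).
rewrite -ge0_integralZl_EFin//; last exact: ltW.
rewrite -ge0_integralD//; last 4 first.
- by move=> t _; rewrite -EFinM lee_fin mulr_ge0// ltW.
- by apply: measurable_funeM.
- by move=> t _; rewrite lee_fin.
- exact/measurable_EFinP.
apply: ge0_le_integral => //.
- by move=> t _; rewrite -EFinM -EFinD lee_fin addr_ge0// mulr_ge0// ltW.
- apply: emeasurable_funD; first exact: measurable_funeM.
  exact/measurable_EFinP.
- apply: emeasurable_funD; first exact/measurable_EFinP.
  by apply/measurable_EFinP; apply: measurableT_comp => //; case: tau_endo.
- by move=> t _; rewrite -EFinM -!EFinD lee_fin; exact: key.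
Qed.

(** The maximal inequality for [h^p] controls the averages of [h] itself, by Jensen's
    inequality. *)
Lemma powR_maximal_ergodic (p : R) (h : T -> R) (K c : R) (N : nat) (E : set T) :
  1 < p -> measurable_fun setT h -> (forall t, 0 <= h t <= K) -> 0 < c ->
  measurable E ->
  E `<=` [set t | exists2 n, (n <= N)%N &
      n%:R * c < \sum_(0 <= i < n) h (iter i tau t)] ->
  ((c `^ p)%:E * mu E <= \int[mu]_t (h t `^ p)%:E)%E.
Proof.
move=> p1 mh hK c0 mE E_gt; have p0 : 0 <= p by lra.
apply: (@maximal_ergodic _ (K `^ p) _ N) => //.
- exact: (@measurableT_comp _ _ _ _ _ _ (@powR R ^~ p)).
- move=> t; have /andP[h0 hk] := hK t; rewrite powR_ge0/=.
  by rewrite ge0_ler_powR// nnegrE// (le_trans h0).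
- exact: powR_gt0.
- move=> t /E_gt[n nN nc]; exists n => //.
  by apply: powR_mean_gt => // i; case/andP: (hK (iter i tau t)).
Qed.

End maximal_ergodic.

(** * Integrals against functions measurable for a sub-sigma-algebra *)

Section sub_sigma_algebra.
Context {R : realType} {d : measure_display} {T : measurableType d}.

Lemma measurable_fun_sub_sigma_algebra (G H : set (set T)) (u : T -> R) :
  sigma_algebra setT H -> G `<=` H ->
  measurable_fun setT (u : g_sigma_algebraType G -> R) ->
  measurable_fun setT (u : g_sigma_algebraType H -> R).
Proof.
move=> sH GH mu_ _ Y mY.
exact: (@sub_sigma_algebra2 _ setT _ _ GH) (mu_ measurableT Y mY).
Qed.

Lemma sigma_subalgebra_measurable_fun (G : set (set T)) (u : T -> R) :
  sigma_subalgebra G ->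
  measurable_fun setT (u : g_sigma_algebraType G -> R) -> measurable_fun setT u.
Proof.
move=> [sG GT] mu_ _ Y mY; apply: GT.
by rewrite -(sigma_algebra_id sG); exact: mu_.
Qed.

Variable mu : {measure set T -> \bar R}.

Lemma integral_mulr_indic (h : T -> R) (A : set T) : measurable A ->
  (\int[mu]_t (h t * \1_A t)%:E = \int[mu]_(t in A) (h t)%:E)%E.
Proof.
move=> mA; rewrite [RHS]integral_mkcond; apply: eq_integral => t _.
by rewrite restrict_EFin/= patchE indicE; case: ifPn => _; rewrite ?mulr1 ?mulr0.
Qed.

(** By linearity the comparison of [u] and [phi] on the sets of [G] extends to
    [G]-measurable simple weights, and by monotone convergence to all
    nonnegative ones. *)
Lemma ge0_le_integral_mulr (G : set (set T)) (u phi k : T -> R) :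
  sigma_subalgebra G -> measurable_fun setT u -> measurable_fun setT phi ->
  (forall t, 0 <= u t) -> (forall t, 0 <= phi t) ->
  (forall A, G A ->
    \int[mu]_(t in A) (u t)%:E <= \int[mu]_(t in A) (phi t)%:E)%E ->
  measurable_fun setT (k : g_sigma_algebraType G -> R) -> (forall t, 0 <= k t) ->
  (\int[mu]_t (u t * k t)%:E <= \int[mu]_t (phi t * k t)%:E)%E.
Proof.
move=> sG mu_ mphi u0 phi0 uphi mk k0.
have mk' : measurable_fun setT (EFin \o k : g_sigma_algebraType G -> \bar R).
  exact/measurable_EFinP.
pose s := nnsfun_approx (@measurableT _ (g_sigma_algebraType G)) mk'.
have GG A : <<s G >> A -> G A by rewrite (sigma_algebra_id sG.1).
have mpre n y : G ((s n : T -> R) @^-1` [set y]).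
  apply: GG.
  exact: (@measurable_funPTI _ _ (g_sigma_algebraType G) _ (s n) _ (measurable_set1 y)).
have ms n : measurable_fun setT (s n : T -> R).
  apply: (sigma_subalgebra_measurable_fun sG).
  exact: (@measurable_funPT _ _ (g_sigma_algebraType G) _ (s n)).
have sE (h : T -> R) n : measurable_fun setT h -> (forall t, 0 <= h t) ->
    (\int[mu]_t (h t * s n t)%:E = \sum_(y \in range (s n))
        y%:E * \int[mu]_(t in (s n : T -> R) @^-1` [set y]) (h t)%:E)%E.
  move=> mh h0.
  have mI y : measurable_fun setT
      (fun t => (h t * \1_((s n : T -> R) @^-1` [set y]) t)%:E).
    apply/measurable_EFinP; apply: measurable_funM => //.
    by apply: measurable_indic; apply: sG.2.
  transitivity (\int[mu]_t (\sum_(y \in range (s n))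
      (y%:E * (h t * \1_((s n : T -> R) @^-1` [set y]) t)%:E)))%E.
    apply: eq_integral => t _.
    rewrite [in LHS](fimfunE (s n)) mulr_fsumr -fsumEFin//.
    by apply: eq_fsbigr => y _; rewrite -EFinM mulrCA.
  rewrite ge0_integral_fsum//; last first.
  - move=> y t _; rewrite -EFinM mulrCA lee_fin mulr_ge0//.
    by have := nnfun_muleindic_ge0 (s n) y t; rewrite -EFinM lee_fin.
  - by move=> y; apply: measurable_funeM.
  apply: eq_fsbigr => y; rewrite inE => -[z _ zy].
  rewrite ge0_integralZl_EFin ?integral_mulr_indic//.
  - exact: sG.2.
  - by move=> t _; rewrite lee_fin mulr_ge0.
  - by rewrite -zy.
have cvgs (h : T -> R) : measurable_fun setT h -> (forall t, 0 <= h t) ->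
    (\int[mu]_t (h t * s n t)%:E @[n --> \oo] --> \int[mu]_t (h t * k t)%:E)%E.
  move=> mh h0.
  rewrite (_ : \int[mu]_t (h t * k t)%:E =
      \int[mu]_t limn (fun n => (h t * s n t)%:E))%E.
    apply: cvg_monotone_convergence => //.
    - by move=> n; apply/measurable_EFinP; exact: measurable_funM.
    - by move=> n t _; rewrite lee_fin mulr_ge0.
    - move=> t _ m n mn; rewrite lee_fin ler_wpM2l//.
      exact: (lefP _ _ (nd_nnsfun_approx _ _ mn)).
  apply: eq_integral => t _; apply/esym/cvg_lim => //.
  have := @cvg_nnsfun_approx _ _ _ _ (@measurableT _ (g_sigma_algebraType G))
    _ mk' (fun t _ => k0 t) t I.
  by move=> /(cvgeZl (y := (h t)%:E) isT).
apply: lee_cvg_to (cvgs _ mu_ u0) (cvgs _ mphi phi0) _.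
near=> n; rewrite !sE//; apply: lee_fsum => // y [z _ zy].
by rewrite lee_wpmul2l ?lee_fin -?zy//; exact/uphi/mpre.
Unshelve. all: by end_near. Qed.

End sub_sigma_algebra.

(** * Doob's inequality *)

(** The maximum of the first [n] functions truncated at the level [K], which keeps
    it bounded. It starts at [0], so that for nonnegative functions the first
    value is a jump like any other. *)
Fixpoint running_max {R : realType} {T : Type} (K : R) (u : nat -> T -> R)
    (n : nat) (t : T) : R :=
  if n is m.+1 then Num.max (running_max K u m t) (Num.min (u m t) K) else 0.
Arguments running_max : simpl never.

Section running_max_theory.
Context {R : realType} {T : Type}.
Implicit Types (K : R) (u : nat -> T -> R) (n : nat) (t : T).

Lemma running_maxS K u n t :
  running_max K u n.+1 t = Num.max (running_max K u n t) (Num.min (u n t) K).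
Proof. by []. Qed.

Lemma running_max_ge0 K u n t : 0 <= running_max K u n t.
Proof. by elim: n => // n IH; rewrite running_maxS le_max IH. Qed.

Lemma running_max_le K u n t : 0 <= K -> running_max K u n t <= K.
Proof.
by move=> K0; elim: n => // n IH; rewrite running_maxS ge_max IH ge_min lexx orbT.
Qed.

Lemma running_max_homo K u n t : running_max K u n t <= running_max K u n.+1 t.
Proof. by rewrite running_maxS le_max lexx. Qed.

Lemma running_max_ge K u n m t : (m < n)%N ->
  Num.min (u m t) K <= running_max K u n t.
Proof.
elim: n => // n IH; rewrite ltnS leq_eqVlt running_maxS le_max => /predU1P[->|/IH ->//].
by rewrite lexx orbT.
Qed.

(** The pathwise form of Doob's inequality. When the running maximum [M] jumps from
    [a] to [b], the new function is at least [b], so it suffices that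
    [(p - 1) (b^p - a^p) <= p b (b^(p-1) - a^(p-1))], which is Young's
    inequality. *)
Lemma running_max_jump (p K : R) u n t : 1 < p -> 0 <= u n t ->
  (p - 1) * (running_max K u n.+1 t `^ p - running_max K u n t `^ p) <=
  p * (u n t *
    (running_max K u n.+1 t `^ (p - 1) - running_max K u n t `^ (p - 1))).
Proof.
move=> p1 u0; rewrite running_maxS; set a := running_max K u n t.
have a0 : 0 <= a by exact: running_max_ge0.
have [_|ab] := leP (Num.min (u n t) K) a; first by rewrite !subrr !mulr0.
set b := Num.min _ _ in ab *.
have b0 : 0 <= b by exact: le_trans (ltW ab).
have bu : b <= u n t by rewrite ge_min lexx.
have H := powR_young p1 b0 a0.
have ab1 : 0 <= b `^ (p - 1) - a `^ (p - 1).
  by rewrite subr_ge0 ge0_ler_powR ?nnegrE ?(ltW ab)// subr_ge0 ltW.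
have p0 : 0 <= p by lra.
apply: le_trans (_ : p * (b * (b `^ (p - 1) - a `^ (p - 1))) <= _); last first.
  by rewrite ler_wpM2l// ler_wpM2r.
rewrite [b * _]mulrBr mulr_powRB1//; last lra.
by rewrite -subr_ge0 in H; rewrite -subr_ge0; apply: (le_trans H); lra.
Qed.

End running_max_theory.

Lemma measurable_running_max {R : realType} {d : measure_display}
    {T : measurableType d} (K : R) (u : nat -> T -> R) (n : nat) :
  (forall i, (i < n)%N -> measurable_fun setT (u i)) ->
  measurable_fun setT (running_max K u n).
Proof.
elim: n => [|n IH] mu_; first exact: measurable_cst.
apply: measurable_maxr; first by apply: IH => i ni; exact/mu_/ltnW.
by apply: measurable_minr => //; exact: mu_.
Qed.

Section doob.
Context {R : realType} {d : measure_display} {T : measurableType d}.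
Variable mu : {finite_measure set T -> \bar R}.
Variables (p K : R) (N : nat) (G : nat -> set (set T)).
Variables (u : nat -> T -> R) (phi : T -> R).
Hypothesis p_gt1 : 1 < p.
Hypothesis K_ge0 : 0 <= K.
Hypothesis G_sub : forall i, (i < N)%N -> sigma_subalgebra (G i).
Hypothesis G_mono : forall i j, (i <= j)%N -> (j < N)%N -> G i `<=` G j.
Hypothesis u_ge0 : forall i t, 0 <= u i t.
Hypothesis u_adapted : forall i, (i < N)%N ->
  measurable_fun setT (u i : g_sigma_algebraType (G i) -> R).
Hypothesis phi_ge0 : forall t, 0 <= phi t.
Hypothesis phi_measurable : measurable_fun setT phi.
Hypothesis u_le_phi : forall i A, (i < N)%N -> G i A ->
  (\int[mu]_(t in A) (u i t)%:E <= \int[mu]_(t in A) (phi t)%:E)%E.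

Local Notation M := (running_max K u).
Let k i t := M i.+1 t `^ (p - 1) - M i t `^ (p - 1).

Let M_adapted i n : (i < N)%N -> (n <= i.+1)%N ->
  measurable_fun setT (M n : g_sigma_algebraType (G i) -> R).
Proof.
move=> iN ni.
apply: (@measurable_running_max _ _ (g_sigma_algebraType (G i))) => j jn.
have ji : (j <= i)%N by exact: leq_trans jn ni.
apply: (@measurable_fun_sub_sigma_algebra _ _ _ (G j)).
- exact: (G_sub iN).1.
- exact: G_mono.
- by apply: u_adapted; exact: leq_ltn_trans iN.
Qed.

Let k_adapted i : (i < N)%N ->
  measurable_fun setT (k i : g_sigma_algebraType (G i) -> R).
Proof.
move=> iN; apply: measurable_funB.
  apply: (@measurableT_comp _ _ _ (g_sigma_algebraType (G i)) _ _
    (@powR R ^~ (p - 1)) setT (M i.+1)) => //; exact: M_adapted.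
apply: (@measurableT_comp _ _ _ (g_sigma_algebraType (G i)) _ _
  (@powR R ^~ (p - 1)) setT (M i)) => //; exact: M_adapted.
Qed.

Let k_ge0 i t : 0 <= k i t.
Proof.
rewrite subr_ge0 ge0_ler_powR ?nnegrE ?running_max_ge0 ?running_max_homo//.
by rewrite subr_ge0 ltW.
Qed.

Let p_gt0 : 0 < p.
Proof. exact: lt_trans p_gt1. Qed.

Let p1_neq0 : p - 1 != 0.
Proof. by rewrite gt_eqF// subr_gt0. Qed.

Let sum_k t : \sum_(0 <= i < N) k i t = M N t `^ (p - 1).
Proof. by rewrite telescope_sumr// [M 0 t]/(0) powR0// subr0. Qed.

Let sum_jump t : (p - 1) * M N t `^ p <= \sum_(0 <= i < N) p * (u i t * k i t).
Proof.
have -> : M N t `^ p = \sum_(0 <= i < N) (M i.+1 t `^ p - M i t `^ p).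
  by rewrite telescope_sumr// [M 0 t]/(0) powR0 ?subr0// gt_eqF.
by rewrite mulr_sumr; apply: ler_sum => i _; exact: running_max_jump.
Qed.

Let measurable_u i : (i < N)%N -> measurable_fun setT (u i).
Proof.
by move=> iN; apply: (sigma_subalgebra_measurable_fun (G_sub iN)); exact: u_adapted.
Qed.

Let measurable_M : measurable_fun setT (M N).
Proof. by apply: measurable_running_max => i; exact: measurable_u. Qed.

Let measurable_powM r : measurable_fun setT (fun t => M N t `^ r).
Proof. exact: (@measurableT_comp _ _ _ _ _ _ (@powR R ^~ r)). Qed.

Let integral_powM_fin : (\int[mu]_t (M N t `^ p)%:E \is a fin_num)%E.
Proof.
rewrite ge0_fin_numE; last by apply: integral_ge0 => t _; rewrite lee_fin powR_ge0.
apply: (@le_lt_trans _ _ (\int[mu]_t (cst (K `^ p)%:E t))%E).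
  apply: ge0_le_integral => //=.
  - by move=> t _; rewrite lee_fin powR_ge0.
  - exact/measurable_EFinP.
  - move=> t _; rewrite lee_fin ge0_ler_powR ?nnegrE ?running_max_ge0 ?running_max_le//.
    exact: ltW.
by rewrite integral_cst// lte_mul_pinfty// ?ltey_eq ?fin_num_measure// lee_fin powR_ge0.
Qed.

Let measurable_k i : (i < N)%N -> measurable_fun setT (k i).
Proof.
by move=> iN; apply: (sigma_subalgebra_measurable_fun (G_sub iN)); exact: k_adapted.
Qed.

(** Summing the pathwise inequality over [i], the weights [k i] are nonnegative and
    [G i]-measurable; this allows replacing each [u i] by [phi], after which
    the weights telescope. *)
Let jump_le : ((p - 1)%:E * \int[mu]_t (M N t `^ p)%:E <=
   p%:E * \int[mu]_t (phi t * M N t `^ (p - 1))%:E)%E.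
Proof.
have integral_sum_k (h : T -> R) : measurable_fun setT h -> (forall t, 0 <= h t) ->
    (\int[mu]_t (\sum_(i < N) (h t * k i t)%:E) =
     \sum_(i < N) \int[mu]_t (h t * k i t)%:E)%E.
  move=> mh h0; apply: ge0_integral_sum => //.
    move=> i; apply/measurable_EFinP.
    by apply: measurable_funM => //; exact: measurable_k.
  by move=> i t _; rewrite lee_fin mulr_ge0.
rewrite -ge0_integralZl_EFin//; last 3 first.
- by move=> t _; rewrite lee_fin powR_ge0.
- exact/measurable_EFinP.
- by rewrite subr_ge0 ltW.
apply: (@le_trans _ _ (\int[mu]_t (\sum_(i < N) p%:E * (u i t * k i t)%:E))%E).
  apply: ge0_le_integral => //.
  - by move=> t _; rewrite -EFinM lee_fin mulr_ge0 ?powR_ge0// subr_ge0 ltW.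
  - by apply: measurable_funeM; exact/measurable_EFinP.
  - apply: emeasurable_sum => i; apply: measurable_funeM; apply/measurable_EFinP.
    by apply: measurable_funM; [exact: measurable_u|exact: measurable_k].
  - move=> t _; rewrite -EFinM; under eq_bigr do rewrite -EFinM.
    by rewrite sumEFin lee_fin (le_trans (sum_jump t))// big_mkord.
rewrite ge0_integral_sum//; last 2 first.
- move=> i; apply: measurable_funeM; apply/measurable_EFinP.
  by apply: measurable_funM; [exact: measurable_u|exact: measurable_k].
- by move=> i t _; rewrite -EFinM lee_fin !mulr_ge0// ltW.
apply: (@le_trans _ _ (\sum_(i < N) p%:E * \int[mu]_t (phi t * k i t)%:E)%E).
  apply: lee_sum => i _; rewrite ge0_integralZl_EFin//; last 3 first.
  - by move=> t _; rewrite lee_fin mulr_ge0.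
  - apply/measurable_EFinP.
    by apply: measurable_funM; [exact: measurable_u|exact: measurable_k].
  - exact: ltW.
  rewrite lee_pmul2l//; apply: (ge0_le_integral_mulr (G_sub (ltn_ord i))) => //.
  - exact: measurable_u.
  - by move=> A; exact: u_le_phi.
  - exact: k_adapted.
rewrite -ge0_sume_distrr; last first.
  by move=> i _; apply: integral_ge0 => t _; rewrite lee_fin mulr_ge0.
rewrite -integral_sum_k// lee_pmul2l// le_eqVlt; apply/orP; left; apply/eqP.
apply: eq_integral => t _.
by rewrite sumEFin -mulr_sumr -sum_k big_mkord.
Qed.

(** Young's inequality at [q * phi], with [q = p / (p - 1)], turns the right-hand side
    of [jump_le] into [I], the integral of [M^p], with coefficient [p - 1] against
    [p] on the left. Truncation makes [I] finite, so one copy remains. *)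
Lemma doob_running_max :
  (\int[mu]_t (M N t `^ p)%:E <=
   ((p / (p - 1)) `^ p)%:E * \int[mu]_t (phi t `^ p)%:E)%E.
Proof.
pose q := p / (p - 1).
have q0 : 0 < q by rewrite divr_gt0// subr_gt0.
have pq : p = q * (p - 1) by rewrite divfK.
have mphiM : measurable_fun setT (fun t => phi t * M N t `^ (p - 1)).
  exact: measurable_funM.
have mphip : measurable_fun setT (fun t => phi t `^ p).
  exact: (@measurableT_comp _ _ _ _ _ _ (@powR R ^~ p)).
have I_fin := integral_powM_fin; have jump := jump_le.
set I := (\int[mu]_t (M N t `^ p)%:E)%E in I_fin jump *.
have I0 : (0 <= I)%E by apply: integral_ge0 => t _; rewrite lee_fin powR_ge0.
have young : (q%:E * (p%:E * \int[mu]_t (phi t * M N t `^ (p - 1))%:E) <=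
    (q `^ p)%:E * \int[mu]_t (phi t `^ p)%:E + (p - 1)%:E * I)%E.
  have Phi0 t : setT t -> (0 <= (phi t `^ p)%:E)%E by rewrite lee_fin powR_ge0.
  have M0 t : setT t -> (0 <= (M N t `^ p)%:E)%E by rewrite lee_fin powR_ge0.
  have mPhi : measurable_fun setT (fun t => (phi t `^ p)%:E).
    exact/measurable_EFinP.
  have mM : measurable_fun setT (fun t => (M N t `^ p)%:E).
    exact/measurable_EFinP.
  have mPhiM : measurable_fun setT (fun t => (phi t * M N t `^ (p - 1))%:E).
    exact/measurable_EFinP.
  have PhiM0 t : setT t -> (0 <= (phi t * M N t `^ (p - 1))%:E)%E.
    by rewrite lee_fin mulr_ge0 ?powR_ge0.
  have q0p : 0 <= q `^ p by exact: powR_ge0.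
  have p10 : 0 <= p - 1 by rewrite subr_ge0 ltW.
  have qp0 : 0 <= q * p by rewrite mulr_ge0// ltW.
  rewrite muleA -EFinM /I -!ge0_integralZl_EFin// -ge0_integralD//; last 4 first.
  - by move=> t _; rewrite -EFinM lee_fin mulr_ge0 ?powR_ge0.
  - exact: measurable_funeM.
  - by move=> t _; rewrite -EFinM lee_fin mulr_ge0 ?powR_ge0.
  - exact: measurable_funeM.
  apply: ge0_le_integral => //.
  - by move=> t Tt; rewrite mule_ge0// ?PhiM0// lee_fin.
  - exact: measurable_funeM.
  - by apply: emeasurable_funD; exact: measurable_funeM.
  move=> t _; rewrite -!EFinM -EFinD lee_fin -(powRM _ (ltW q0))//.
  apply: le_trans (powR_young p_gt1 _ (running_max_ge0 _ _ _ _)); last first.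
    by rewrite mulr_ge0// ltW.
  by rewrite (_ : q * p * _ = p * (q * phi t * M N t `^ (p - 1))) //; ring.
have : (p%:E * I <= (q `^ p)%:E * \int[mu]_t (phi t `^ p)%:E + (p - 1)%:E * I)%E.
  apply: le_trans young; rewrite {1}pq EFinM -muleA.
  by rewrite lee_pmul2l// lte_fin.
have -> : (p%:E * I = I + (p - 1)%:E * I)%E.
  rewrite -[in LHS](subrKC 1 p) EFinD ge0_muleDl ?lee_fin ?subr_ge0 ?ltW//.
  by rewrite mul1e.
by rewrite leeD2rE// fin_numM.
Qed.

End doob.

(** * Strongly measurable functions *)

Section strong_measurability.
Context {R : realType} {X : normedModType R}.
Context {d : measure_display} {T : measurableType d}.
Implicit Types (G : set (set T)) (f g s : T -> X).

Lemma simple_function_preimage2 G s1 s2 (P : X -> X -> Prop) :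
  sigma_algebra setT G -> simple_function G s1 -> simple_function G s2 ->
  G [set t | P (s1 t) (s2 t)].
Proof.
move=> sG [f1 G1] [f2 G2].
pose D := [set z | [/\ range s1 z.1, range s2 z.2 & P z.1 z.2]].
pose B (z : X * X) := s1 @^-1` [set z.1] `&` s2 @^-1` [set z.2].
rewrite (_ : [set t | _] = \bigcup_(z in D) B z); last first.
  apply/seteqP; split => t /=; last by move=> [z [_ _ ?] [-> ->]].
  by move=> Pt; exists (s1 t, s2 t).
have finD : finite_set D.
  by apply: sub_finite_set (finite_setX f1 f2) => z [].
rewrite -(sigma_algebra_id sG).
apply: (@fin_bigcup_measurable _ (g_sigma_algebraType G)) => // z _.
apply: (@measurableI _ (g_sigma_algebraType G)); exact: sub_sigma_algebra.
Qed.

Lemma simple_function_map2 G s1 s2 (h : X -> X -> X) :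
  sigma_algebra setT G -> simple_function G s1 -> simple_function G s2 ->
  simple_function G (fun t => h (s1 t) (s2 t)).
Proof.
move=> sG s1G s2G; split; last first.
  move=> x; exact: (@simple_function_preimage2 G s1 s2 (fun a b => h a b = x)).
apply: sub_finite_set (finite_image2 h s1G.1 s2G.1) => _ [t _ <-].
by exists (s1 t); [exists t|exists (s2 t); [exists t|]].
Qed.

Lemma simple_function_strongly_measurable G s :
  simple_function G s -> strongly_measurable G s.
Proof. by move=> ?; exists (fun=> s); split=> // t; exact: cvg_cst. Qed.

Lemma strongly_measurable_cst G (x : X) :
  sigma_algebra setT G -> strongly_measurable G (fun=> x).
Proof.
move=> sG; apply: simple_function_strongly_measurable; split.
  by apply: sub_finite_set (finite_set1 x) => _ [t _ <-].
move=> y; rewrite -(sigma_algebra_id sG).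
rewrite preimage_cst; case: ifP => _.
  exact: (@measurableT _ (g_sigma_algebraType G)).
exact: (@measurable0 _ (g_sigma_algebraType G)).
Qed.

Lemma strongly_measurableD G f g : sigma_algebra setT G ->
  strongly_measurable G f -> strongly_measurable G g ->
  strongly_measurable G (fun t => f t + g t).
Proof.
move=> sG [sf [sfG sf_cvg]] [sg [sgG sg_cvg]].
exists (fun n t => sf n t + sg n t); split; last by move=> t; exact: cvgD.
by move=> n; exact: (@simple_function_map2 _ (sf n) (sg n) (fun a b => a + b)).
Qed.

Lemma strongly_measurableZ G f (a : R) : sigma_algebra setT G ->
  strongly_measurable G f -> strongly_measurable G (fun t => a *: f t).
Proof.
move=> sG [sf [sfG sf_cvg]].
exists (fun n t => a *: sf n t); split; last by move=> t; exact: cvgZr.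
by move=> n; exact: (@simple_function_map2 _ (sf n) (sf n) (fun x _ => a *: x)).
Qed.

Lemma strongly_measurable_comp f (tau : T -> T) : measurable_fun setT tau ->
  strongly_measurable measurable f -> strongly_measurable measurable (f \o tau).
Proof.
move=> mtau [s [sG s_cvg]]; exists (fun n => s n \o tau).
split; last by move=> t; exact: s_cvg.
move=> n; have [fs ms] := sG n; split.
  by apply: sub_finite_set fs => _ [t _ <-]; exists (tau t).
move=> x; rewrite comp_preimage -[X in measurable X]setTI; exact: mtau.
Qed.

(** Norms of strongly measurable functions are measured for [G] itself, hence the
    carrier type of the domain: Doob's inequality and the partition in
    [condexp_norm_le] need level sets that belong to [G]. *)
Lemma measurable_dist_sub G f g : sigma_algebra setT G ->
  strongly_measurable G f -> strongly_measurable G g ->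
  measurable_fun setT ((fun t => `|f t - g t|) : g_sigma_algebraType G -> R).
Proof.
move=> sG [sf [sfG sf_cvg]] [sg [sgG sg_cvg]].
apply: (@measurable_fun_cvg _ (g_sigma_algebraType G) _ _
  (fun n t => `|sf n t - sg n t|)).
  move=> n _ B mB; rewrite setTI; apply: sub_sigma_algebra.
  exact: (@simple_function_preimage2 G (sf n) (sg n) (fun a b => B `|a - b|)).
by move=> t _; apply: cvg_norm; exact: cvgB.
Qed.

Lemma measurable_norm_sub G f : sigma_algebra setT G -> strongly_measurable G f ->
  measurable_fun setT ((fun t => `|f t|) : g_sigma_algebraType G -> R).
Proof.
move=> sG mf; rewrite (_ : (fun t => `|f t|) = fun t => `|f t - 0|); last first.
  by apply/funext => t; rewrite subr0.
by apply: measurable_dist_sub => //; exact: strongly_measurable_cst.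
Qed.

Lemma measurable_dist f g :
  strongly_measurable measurable f -> strongly_measurable measurable g ->
  measurable_fun setT (fun t => `|f t - g t|).
Proof.
move=> mf mg; apply: (@sigma_subalgebra_measurable_fun _ _ _ measurable).
  by split => //; exact: sigma_algebra_measurable.
by apply: measurable_dist_sub => //; exact: sigma_algebra_measurable.
Qed.

Lemma measurable_norm f :
  strongly_measurable measurable f -> measurable_fun setT (fun t => `|f t|).
Proof.
move=> mf; apply: (@sigma_subalgebra_measurable_fun _ _ _ measurable).
  by split => //; exact: sigma_algebra_measurable.
by apply: measurable_norm_sub => //; exact: sigma_algebra_measurable.
Qed.

Lemma strongly_measurable_subset G f : G `<=` measurable ->
  strongly_measurable G f -> strongly_measurable measurable f.
Proof.
move=> GT [s [sG s_cvg]]; exists s; split => // n.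
by have [? sn] := sG n; split => // x; exact: GT.
Qed.

End strong_measurability.

(** * Norm estimates for Bochner integrals and conditional expectations *)

Section bochner_estimates.
Context {R : realType} {X : completeNormedModType R}.
Context {d : measure_display} {T : measurableType d}.
Variable mu : {finite_measure set T -> \bar R}.
Implicit Types (A : set T) (f g s : T -> X).

Lemma simple_integral_dist A s (x : X) : measurable A ->
  simple_function measurable s ->
  (`|simple_integral mu A s - fine (mu A) *: x|%:E <=
   \int[mu]_(t in A) `|s t - x|%:E)%E.
Proof.
move=> mA [fs ms].
pose r := finmap.enum_fset (fset_set (range s)).
pose B y := A `&` s @^-1` [set y].
have mB y : measurable (B y) by exact: measurableI.
have AE : A = \big[setU/set0]_(y <- r) B y.
  rewrite -bigcup_seq; apply/seteqP; split => [t At|t [y _ []//]].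
  by exists (s t) => //=; rewrite in_fset_set// inE; exists t.
have tB : trivIset [set` r] B.
  by move=> i j _ _ [t [[_ <-] [_ <-]]].
have r_uniq : uniq r by exact: finmap.fset_uniq.
have muA : fine (mu A) = \sum_(y <- r) fine (mu (B y)).
  rewrite {1}AE measure_fbigsetU// sum_fine// => y _; exact: fin_num_measure.
have mdist : measurable_fun setT (fun t => `|s t - x|).
  apply: measurable_dist.
    by apply: simple_function_strongly_measurable.
  by apply: strongly_measurable_cst; exact: sigma_algebra_measurable.
have -> : (\int[mu]_(t in A) `|s t - x|%:E =
    \sum_(y <- r) (fine (mu (B y)) * `|y - x|)%:E)%E.
  rewrite {1}AE ge0_integral_bigsetU//; last first.
    by apply: measurable_funS (iffRL (measurable_EFinP _ _) mdist).
  apply: eq_bigr => y _; rewrite EFinM fineK ?fin_num_measure// muleC.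
  rewrite -integral_cst//; apply: eq_integral => t; rewrite inE => -[_ /= <-//].
rewrite /simple_integral fsbig_finite//= muA scaler_suml -sumrB sumEFin lee_fin.
apply: le_trans (ler_norm_sum _ _ _) _; apply: ler_sum => y _.
by rewrite -scalerBr normrZ ger0_norm// fine_ge0.
Qed.

(** For [x = 0] this is the triangle inequality for the Bochner integral; in general
    it says that a function close to [x] integrates to nearly [mu A * x]. *)
Lemma bochner_integral_dist A f (v x : X) : measurable A ->
  has_bochner_integral mu A f v ->
  (`|v - fine (mu A) *: x|%:E <= \int[mu]_(t in A) `|f t - x|%:E)%E.
Proof.
move=> mA [mf [s [sG s_cvg v_cvg]]].
have ms n := simple_function_strongly_measurable (sG n).
have mx : strongly_measurable measurable (fun _ : T => x).
  by apply: strongly_measurable_cst; exact: sigma_algebra_measurable.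
have mE (h : T -> R) : measurable_fun setT h -> measurable_fun A (EFin \o h).
  by move=> mh; apply: measurable_funS (iffRL (measurable_EFinP _ _) mh).
have bound n : (`|simple_integral mu A (s n) - fine (mu A) *: x|%:E <=
    \int[mu]_(t in A) `|f t - s n t|%:E + \int[mu]_(t in A) `|f t - x|%:E)%E.
  apply: le_trans (simple_integral_dist x mA (sG n)) _.
  rewrite -ge0_integralD//; last 2 first.
  - by apply/mE; exact: measurable_dist.
  - by apply/mE; exact: measurable_dist.
  apply: ge0_le_integral => //.
  - by apply/mE; exact: measurable_dist.
  - by apply: emeasurable_funD; apply/mE; exact: measurable_dist.
  - move=> t _; rewrite -EFinD lee_fin -(distrC (s n t)).
    exact: ler_distD.
have lhs : (`|simple_integral mu A (s n) - fine (mu A) *: x|%:E @[n --> \oo] -->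
    `|v - fine (mu A) *: x|%:E)%E.
  apply/fine_cvgP; split; first exact: nearW.
  by apply: cvg_norm; apply: cvgB => //; exact: cvg_cst.
rewrite -[leRHS]add0e; apply: lee_cvg_to lhs _ _; last by near=> n; exact: bound.
by apply: cvgeD => //; exact: cvg_cst.
Unshelve. all: by end_near. Qed.

(** The conditional Jensen inequality for the norm, integrated over a set of [G].
    The simple functions tending to [g] take countably many values [e k] in
    all, so the sets [C k] where [g] is [eps]-close to [e k] cover the space.
    They belong to [G], and so do the pieces of [A] that they cut out; on each
    of these the integrals of [f] and [g] agree. *)
Lemma condexp_norm_le (G : set (set T)) f g A : sigma_subalgebra G ->
  is_condexp mu G f g -> G A ->
  (\int[mu]_(t in A) `|g t|%:E <= \int[mu]_(t in A) `|f t|%:E)%E.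
Proof.
move=> sG [mg _ fg] GA; have [sGT GT] := sG.
have mf : strongly_measurable measurable f.
  have [v [[]]] // := fg _ GA.
have mg' : strongly_measurable measurable g by exact: strongly_measurable_subset mg.
have mx (x : X) : strongly_measurable measurable (fun _ : T => x).
  by apply: strongly_measurable_cst; exact: sigma_algebra_measurable.
have mE (h : T -> R) B : measurable_fun setT h -> measurable_fun B (EFin \o h).
  by move=> mh; apply: measurable_funS (iffRL (measurable_EFinP _ _) mh).
have nf := measurable_norm mf.
have ng := measurable_norm mg'.
have mA := GT _ GA.
apply/lee_addgt0Pr => delta delta0.
pose m := fine (mu A).
have m0 : 0 <= m by exact: fine_ge0.
(* Each piece loses [2 * eps] times its measure; [+ 1] because [m] may vanish. *)
pose eps := delta / (2 * (m + 1)).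
have eps0 : 0 < eps by rewrite divr_gt0// mulr_gt0//; lra.
have eps_delta : (2 * eps) * m <= delta.
  rewrite (_ : _ * m = delta * (m / (m + 1))); last by rewrite /eps; field; lra.
  by rewrite ger_pMr// ler_pdivrMr; lra.
have GT' : <<s G >> = G by exact: sigma_algebra_id.
have [s [sG' s_cvg]] := mg.
pose D := \bigcup_n range (s n).
have cD : countable D.
  apply: bigcup_countable => // n _.
  by apply: finite_set_countable; have [] := sG' n.
have /pcard_surjP[e De] := cD.
pose C k := [set t | `|g t - e k| < eps].
have GC k : G (C k).
  have cG : strongly_measurable G (fun _ : T => e k).
    exact: strongly_measurable_cst.
  have := measurable_dist_sub sGT mg cG measurableT (measurable_itv `]-oo, eps[).
  rewrite setTI => Ck; rewrite -GT'.
  suff -> : C k = [set t | `|g t - e k| \in `]-oo, eps[] by exact: Ck.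
  by apply/seteqP; split => t /=; rewrite in_itv.
have CT : \bigcup_k C k = setT.
  rewrite -subTset => t _.
  have /cvgrPdist_lt/(_ _ eps0)[n _ /(_ n (leqnn n))/= gs] := s_cvg t.
  have [k _ ek] : (e @` setT) (s n t) by apply: De; exists n => //; exists t.
  by exists k => //; rewrite /C/= ek.
pose B := seqDU C.
have GB k : G (A `&` B k).
  rewrite -GT'; apply: (@measurableI _ (g_sigma_algebraType G)).
    exact: sub_sigma_algebra.
  apply: (@seqDU_measurable _ (g_sigma_algebraType G)) => n.
  exact: sub_sigma_algebra.
have mB k : measurable (A `&` B k) by exact: GT.
have AE : A = \bigcup_k (A `&` B k).
  by rewrite -setI_bigcupr -seqDU_bigcup_eq CT setIT.
have tB : trivIset setT (fun k => A `&` B k).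
  by apply: trivIset_setIl; exact: trivIset_seqDU.
have piece k : (\int[mu]_(t in A `&` B k) `|g t|%:E <=
    \int[mu]_(t in A `&` B k) (`|f t| + 2 * eps)%:E)%E.
  set Bk := A `&` B k; have mBk : measurable Bk by exact: mB.
  have ge_ek t : Bk t -> `|g t - e k| <= eps.
    by move=> [_ Bt]; apply: ltW; exact: (@subset_seqDU _ C k _ Bt).
  have [v [fv gv]] := fg _ (GB k).
  have f_ge : (`|v|%:E <= \int[mu]_(t in Bk) `|f t|%:E)%E.
    have := bochner_integral_dist 0 (mB k) fv; rewrite scaler0 subr0.
    by under eq_integral do rewrite subr0.
  have muBk : (mu Bk = (fine (mu Bk))%:E)%E by rewrite fineK// fin_num_measure.
  have cst_eps c : (\int[mu]_(t in Bk) c%:E = (c * fine (mu Bk))%:E)%E.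
    by rewrite (integral_cst _ (mB k))/= EFinM -muBk.
  have g_ek : (`|v - fine (mu Bk) *: e k|%:E <= (eps * fine (mu Bk))%:E)%E.
    apply: le_trans (bochner_integral_dist _ (mB k) gv) _; rewrite -cst_eps.
    by apply: ge0_le_integral => //; apply: mE; exact: measurable_dist.
  apply: (@le_trans _ _ (\int[mu]_(t in Bk) (eps + `|e k|)%:E)%E).
    apply: ge0_le_integral => //; first exact: (mE _ _ ng).
    move=> t /ge_ek; rewrite lee_fin => ge_eps.
    by rewrite -[g t](subrK (e k)) (le_trans (ler_normD _ _))// lerD2r.
  under [leRHS]eq_integral do rewrite EFinD.
  rewrite ge0_integralD//; last 2 first.
  - exact: (mE _ _ nf).
  - by move=> t _; rewrite lee_fin mulr_ge0// ltW.
  rewrite !cst_eps.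
  apply: (@le_trans _ _ (`|v| + 2 * eps * fine (mu Bk))%:E); last first.
    by rewrite EFinD leeD2r.
  rewrite lee_fin; move: g_ek; rewrite lee_fin => g_ek.
  have mub0 : 0 <= fine (mu Bk) by exact: fine_ge0.
  have : fine (mu Bk) * `|e k| <= `|v| + eps * fine (mu Bk).
    rewrite -{1}(ger0_norm mub0) -normrZ -[_ *: _](subKr v).
    by rewrite (le_trans (ler_normB _ _))// lerD2l.
  by clear -eps; move=> ek_le; lra.
apply: (@le_trans _ _ (\int[mu]_(t in A) (`|f t| + 2 * eps)%:E)%E).
  rewrite AE !ge0_integral_bigcup//.
  - apply: lee_nneseries => // k _ _.
    by apply: integral_ge0 => t _; rewrite lee_fin.
  - by apply: mE; exact: measurable_funD.
  - by move=> t _; rewrite lee_fin addr_ge0// mulr_ge0// ltW.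
  - exact: (mE _ _ ng).
under eq_integral do rewrite EFinD.
rewrite ge0_integralD//; last 2 first.
- exact: (mE _ _ nf).
- by move=> t _; rewrite lee_fin mulr_ge0// ltW.
by rewrite leeD2l// (integral_cst _ mA)/= -[mu A]fineK ?fin_num_measure.
Qed.

End bochner_estimates.

(** * Maximal inequality for ergodic averages of conditional expectations *)

Section measurable_preliminaries.
Context {R : realType} {d : measure_display} {T : measurableType d}.

Lemma measurable_superlevel (h : T -> R) (c : R) :
  measurable_fun setT h -> measurable [set t | c < h t].
Proof.
move=> mh; have := mh measurableT _ (measurable_itv `]c, +oo[).
rewrite setTI; congr measurable.
by apply/seteqP; split => t /=; rewrite in_itv/= andbT.
Qed.

Lemma measurable_iter (tau : T -> T) (n : nat) :
  measurable_fun setT tau -> measurable_fun setT (iter n tau).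
Proof.
move=> mtau; elim: n => [|n IH]; first exact: measurable_id.
exact: measurableT_comp.
Qed.

(** A supremum may reach [c] without any member of the family doing so; this is
    why a weak superlevel set of a supremum is a countable intersection of
    unions of strict superlevel sets. *)
Lemma ereal_sup_superlevel (J : Type) (D : set J) (h : J -> T -> R) (c : R) :
  [set t | (c%:E <= ereal_sup [set (h i t)%:E | i in D])%E] =
  \bigcap_k \bigcup_(i in D) [set t | c - k.+1%:R^-1 < h i t].
Proof.
apply/seteqP; split => t /=.
  move=> ct k _.
  have ck : ((c - k.+1%:R^-1)%:E < c%:E)%E.
    by rewrite lte_fin ltrBlDr ltrDl invr_gt0.
  have /ereal_sup_gt[_ [i Di <-]] := lt_le_trans ck ct.
  by rewrite lte_fin => ci; exists i.
move=> ht; rewrite leNgt; apply/negP => sup_lt.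
have ht_gt k : exists2 i, D i & c - k.+1%:R^-1 < h i t.
  by have [i] := ht k I; exists i.
set s := ereal_sup _ in sup_lt.
have le_s i : D i -> ((h i t)%:E <= s)%E.
  by move=> Di; apply: ereal_sup_ubound; exists i.
case: s sup_lt le_s => [r| |]; rewrite ?lte_fin//.
- move=> /ltr_add_invr[k rk] le_r; have [i Di ki] := ht_gt k.
  have := le_r i Di; rewrite lee_fin leNgt => /negP; apply.
  by apply: lt_trans ki; rewrite ltrBrDr.
- by move=> _ le_ny; have [i Di _] := ht_gt 0%N; have := le_ny i Di.
Qed.

End measurable_preliminaries.

Section ergodic_averages.
Context {R : realType} {X : normedModType R}.

Lemma iter_generated_operator {T U : Type} (tau : T -> T) (g : T -> U)
    (i : nat) (t : T) :
  iter i (generated_operator tau) g t = g (iter i tau t).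
Proof. by elim: i t => // i IH t; rewrite [in RHS]iterSr; exact: IH. Qed.

Lemma norm_ergodic_average_gt {T : Type} (tau : T -> T) (n : nat) (g : T -> X)
    (t : T) (c : R) : (0 < n)%N ->
  c < `|ergodic_average (generated_operator tau) n g t| ->
  n%:R * c < \sum_(0 <= i < n) `|g (iter i tau t)|.
Proof.
move=> n0; rewrite /ergodic_average normrZ ger0_norm ?invr_ge0//.
rewrite ltr_pdivlMl ?ltr0n// => /lt_le_trans; apply.
apply: le_trans (ler_norm_sum _ _ _) _.
by apply: ler_sum => i _; rewrite iter_generated_operator.
Qed.

Lemma strongly_measurable_ergodic_average {d : measure_display}
    {T : measurableType d} (tau : T -> T) (n : nat) (g : T -> X) :
  measurable_fun setT tau -> strongly_measurable measurable g ->
  strongly_measurable measurable (ergodic_average (generated_operator tau) n g).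
Proof.
move=> mtau mg; have sT := sigma_algebra_measurable T.
apply: strongly_measurableZ => //; elim: n => [|n IH].
  under [X in strongly_measurable _ X]eq_fun do rewrite big_geq//.
  exact: strongly_measurable_cst.
under [X in strongly_measurable _ X]eq_fun do
  rewrite big_nat_recr//= iter_generated_operator.
apply: strongly_measurableD => //.
by apply: (@strongly_measurable_comp _ _ _ _ g (iter n tau)) => //;
  exact: measurable_iter.
Qed.

End ergodic_averages.

Section ergodic_maximal_inequality.
Context {R : realType} {X : completeNormedModType R}.
Context {d : measure_display} {T : measurableType d}.
Variable mu : {finite_measure set T -> \bar R}.
Variables (F : nat -> set (set T)) (Finf : set (set T)).
Hypothesis F_sub : forall n, (1 <= n)%N -> sigma_subalgebra (F n).
Hypothesis F_mono : increases_to F Finf \/ decreases_to F Finf.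
Variables (p : R) (f : T -> X) (Ef : nat -> T -> X).
Hypothesis p_gt1 : 1 < p.
Hypothesis f_measurable : strongly_measurable measurable f.
Hypothesis Ef_condexp : forall n, (1 <= n)%N -> is_condexp mu (F n) f (Ef n).

Let C := (((p / (p - 1)) `^ p)%:E * \int[mu]_t (`|f t| `^ p)%:E)%E.

(** Doob's inequality for the first [N] conditional expectations. Only finitely
    many of them are compared, so that a decreasing sequence of sigma-algebras
    is as good as an increasing one: it is enumerated backwards. *)
Lemma doob_condexp (N : nat) :
  exists h : T -> R, [/\ measurable_fun setT h, forall t, 0 <= h t <= N%:R,
    forall j t, (1 <= j <= N)%N -> Num.min `|Ef j t| N%:R <= h t &
    (\int[mu]_t (h t `^ p)%:E <= C)%E].
Proof.
have [r [r_in r_onto F_r]] : exists r : nat -> nat,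
  [/\ forall i, (i < N)%N -> (1 <= r i)%N,
      forall j, (1 <= j <= N)%N -> exists2 i, (i < N)%N & r i = j &
      forall i j, (i <= j)%N -> (j < N)%N -> F (r i) `<=` F (r j)].
  case: F_mono => -[F_le _].
    exists S; split => //; last by move=> i j ij _; exact: F_le.
    by move=> [//|j] /andP[_ jN]; exists j.
  exists (fun i => N - i)%N; split.
  - by move=> i iN; rewrite subn_gt0.
  - move=> j /andP[j1 jN]; exists (N - j)%N; last by rewrite subKn.
    by rewrite ltn_subrL j1 (leq_trans j1).
  - move=> i j ij jN; apply: F_le; first by rewrite subn_gt0.
    exact: leq_sub2l.
pose u i t := `|Ef (r i) t|.
have u_adapted i : (i < N)%N ->
    measurable_fun setT (u i : g_sigma_algebraType (F (r i)) -> R).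
  move=> iN; apply: measurable_norm_sub; first exact: (F_sub (r_in _ iN)).1.
  by have [] := Ef_condexp (r_in _ iN).
have mu_ i : (i < N)%N -> measurable_fun setT (u i).
  move=> iN; apply: (sigma_subalgebra_measurable_fun (F_sub (r_in _ iN))).
  exact: u_adapted.
exists (running_max N%:R u N); split.
- exact: measurable_running_max.
- by move=> t; rewrite running_max_ge0 running_max_le.
- by move=> j t /r_onto[i iN <-]; exact: (running_max_ge N%:R u).
apply: (@doob_running_max _ _ _ mu p N%:R N (fun i => F (r i)) u) => //.
- by move=> i iN; exact/F_sub/r_in.
- by move=> i t; rewrite /u.
- exact: measurable_norm.
- move=> i A iN FA; apply: condexp_norm_le FA; first exact/F_sub/r_in.
  exact/Ef_condexp/r_in.
Qed.

Variable tau : T -> T.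
Hypothesis tau_endo : endomorphism mu tau.

Let mEf n : (1 <= n)%N -> strongly_measurable measurable (Ef n).
Proof.
move=> n1; apply: strongly_measurable_subset (F_sub n1).2 _.
by have [] := Ef_condexp n1.
Qed.

Let valid := [set n : nat * nat | (1 <= n.1)%N /\ (1 <= n.2)%N].

Let V c := \bigcup_(n in valid)
  [set t | c < `|ergodic_average (generated_operator tau) n.1 (Ef n.2) t|].

Lemma measurable_ergodic_superlevel c : measurable (V c).
Proof.
rewrite /V bigcup_mkcond; apply: countable_bigcupT_measurable => // n.
case: ifPn => // /set_mem[n1 n2]; apply: measurable_superlevel.
apply: measurable_norm; apply: strongly_measurable_ergodic_average.
  exact: tau_endo.1.
exact: mEf.
Qed.

(** For the strict superlevel set the two suprema are exhausted by finite ones: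
    the set increases to [V c] as more averages, more conditional expectations
    and a higher truncation level [N] are allowed, and at each stage the
    truncated maximum of the norms dominates. *)
Lemma ergodic_superlevel_le c : 0 < c -> ((c `^ p)%:E * mu (V c) <= C)%E.
Proof.
move=> c0.
pose A N := [set t | exists n j, [/\ (1 <= n <= N)%N, (1 <= j <= N)%N &
  n%:R * c < \sum_(0 <= i < n) Num.min `|Ef j (iter i tau t)| N%:R]].
have mA N : measurable (A N).
  rewrite (_ : A N = \bigcup_n \bigcup_(j in [set j | (1 <= j)%N])
     [set t | ((1 <= n <= N) && (j <= N))%N /\
       n%:R * c < \sum_(0 <= i < n) Num.min `|Ef j (iter i tau t)| N%:R]); last first.
    apply/seteqP; split => t /=.
      move=> [n [j [nN /andP[j1 jN] nc]]]; exists n => //; exists j => //.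
      by rewrite nN jN.
    by move=> [n _ [j j1 /= [/andP[nN jN] nc]]]; exists n, j; rewrite nN j1 jN.
  apply: bigcupT_measurable => n; apply: bigcup_measurable => j j1.
  have [_|_] := boolP ((1 <= n <= N) && (j <= N))%N; last first.
    by rewrite (_ : [set t | _] = set0)//; apply/seteqP; split => t // [].
  rewrite (_ : [set t | _] = [set t | n%:R * c <
    \sum_(0 <= i < n) Num.min `|Ef j (iter i tau t)| N%:R]); last first.
    by apply/seteqP; split => t // [].
  apply: measurable_superlevel; apply: measurable_sum => i.
  apply: measurable_minr => //.
  apply: (measurableT_comp (measurable_norm (mEf j1))).
  by apply: measurable_iter; exact: tau_endo.1.
have A_nd : nondecreasing_seq A.
  move=> N M NM; apply/subsetPset => t [n [j [/andP[n1 nN] /andP[j1 jN] nc]]].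
  exists n, j; rewrite n1 j1 (leq_trans nN)// (leq_trans jN)//; split => //.
  apply: (lt_le_trans nc); apply: ler_sum => i _.
  by rewrite le_min2// ler_nat.
have VA : V c `<=` \bigcup_N A N.
  move=> t [[n j] [/= n1 j1] ct].
  (* A level above the norms along this piece of the orbit: no truncation. *)
  pose b := \sum_(0 <= i < n) `|Ef j (iter i tau t)|.
  pose N := (n + j + Num.truncn b).+1.
  exists N => //; exists n, j; split; [lia|lia|].
  apply: (lt_le_trans (norm_ergodic_average_gt n1 ct)).
  rewrite le_eqVlt; apply/orP; left; apply/eqP; apply: eq_big_nat => i /andP[_ iN].
  apply/esym/min_idPl; apply: (@le_trans _ _ b).
    rewrite /b (bigD1_seq i) ?mem_index_iota ?iota_uniq//= lerDl.
    exact: sumr_ge0.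
  by apply: le_trans (ltW (truncnS_gt b)) _; rewrite ler_nat ltnS leq_addl.
have boundA N : ((c `^ p)%:E * mu (A N) <= C)%E.
  have [h [mh hN Ef_le h_le]] := doob_condexp N.
  apply: le_trans h_le.
  apply: (@powR_maximal_ergodic _ _ _ mu tau tau_endo p h N%:R c N) => //.
  move=> t [n [j [/andP[n1 nN] jN nc]]]; exists n => //.
  by apply: (lt_le_trans nc); apply: ler_sum => i _; exact: Ef_le.
have mUA : measurable (\bigcup_N A N) by exact: bigcupT_measurable.
apply: (@le_trans _ _ ((c `^ p)%:E * mu (\bigcup_N A N))%E).
  rewrite lee_pmul2l ?lte_fin ?powR_gt0// le_measure// inE//.
  exact: measurable_ergodic_superlevel.
have A_cvg := nondecreasing_cvg_mu (mu := mu) mA mUA A_nd.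
apply: (cvge_to_le (cvgeZl (y := (c `^ p)%:E) isT A_cvg)).
exact: nearW.
Qed.

(** The weak superlevel set at [eps] lies in the strict ones at every [c < eps];
    the bound passes to the limit as the factor [c `^ p] increases to
    [eps `^ p]. *)
Lemma ergodic_sup_superlevel_le (eps : R) : 0 < eps ->
  ((eps `^ p)%:E * mu [set t | eps%:E <=
     ereal_sup [set (`|ergodic_average (generated_operator tau) n.1 (Ef n.2) t|)%:E
               | n in valid]] <= C)%E.
Proof.
move=> eps0; have p0 : 0 < p by exact: lt_trans p_gt1.
set W := [set t | _].
have WE : W = \bigcap_k V (eps - k.+1%:R^-1).
  exact: (ereal_sup_superlevel valid (fun n t =>
    `|ergodic_average (generated_operator tau) n.1 (Ef n.2) t|)).
have mW : measurable W.
  by rewrite WE; apply: bigcapT_measurable => k; exact: measurable_ergodic_superlevel.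
have WV c : c < eps -> W `<=` V c.
  move=> /ltr_add_invr[k kc]; rewrite WE => t /(_ k I)[n nv nt]; exists n => //.
  by apply: lt_trans nt; rewrite ltrBrDr.
have epsp0 : 0 < eps `^ p by exact: powR_gt0.
apply/lee_mul01Pr => [|r /andP[r0 r1]].
  by rewrite mule_ge0// lee_fin powR_ge0.
rewrite muleA -EFinM.
pose c := (r * eps `^ p) `^ p^-1.
have c0 : 0 < c by rewrite powR_gt0// mulr_gt0.
have cE : c `^ p = r * eps `^ p.
  by rewrite -powRrM mulVf ?gt_eqF// powRr1// mulr_ge0// ltW.
have c_eps : c < eps.
  rewrite ltNge; apply/negP => eps_c.
  have : eps `^ p <= c `^ p by rewrite ge0_ler_powR ?nnegrE// ltW.
  by rewrite cE leNgt gtr_pMl// r1.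
apply: le_trans (ergodic_superlevel_le c0); rewrite cE.
rewrite lee_pmul2l ?lte_fin ?mulr_gt0// le_measure ?inE//; last exact: WV.
exact: measurable_ergodic_superlevel.
Qed.

End ergodic_maximal_inequality.

Theorem theorem3p5 (R : realType) (X : completeNormedModType R)
    (X_reflexive : reflexive_space X)
    (d : measure_display) (Omega : measurableType d)
    (mu : {finite_measure set Omega -> \bar R})
    (F : nat -> set (set Omega)) (Finf : set (set Omega))
    (F_sub : forall n, (1 <= n)%N -> sigma_subalgebra (F n))
    (F_mono : increases_to F Finf \/ decreases_to F Finf)
    (tau : Omega -> Omega) (tau_endo : endomorphism mu tau)
    (p : R) (p_gt1 : 1 < p)
    (f : Omega -> X) (f_Lp : bochner_Lp mu p f)
    (Ef : nat -> Omega -> X)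
    (Ef_condexp : forall n, (1 <= n)%N -> is_condexp mu (F n) f (Ef n))
    (sup_Ef_L1 : mu.-integrable setT
       (fun w => ereal_sup [set (`|Ef n w|)%:E | n in [set n | (1 <= n)%N]]))
    (eps : R) (eps_gt0 : 0 < eps) :
  (mu [set w | eps%:E <=
       ereal_sup [set (`|ergodic_average (generated_operator tau) n.1 (Ef n.2) w|)%:E
                 | n in [set n : nat * nat | (1 <= n.1)%N /\ (1 <= n.2)%N]]]
   <= ((p / (p - 1)) `^ p)%:E * (bochner_norm mu p f `^ p / (eps `^ p)%:E))%E.
Proof.
have := ergodic_sup_superlevel_le F_sub F_mono p_gt1 f_Lp.1 Ef_condexp tau_endo eps_gt0.
have epsp0 : 0 < eps `^ p by exact: powR_gt0.
have normE : (bochner_norm mu p f `^ p = \int[mu]_t (`|f t| `^ p)%:E)%E.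
  rewrite poweR_Lnorm; last by rewrite gt_eqF// (lt_trans _ p_gt1).
  by apply: eq_integral => t _ /=; rewrite normr_id.
by rewrite normE muleA inver gt_eqF// lee_pdivlMr// muleC.
Qed.
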